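(* Let $p\geqslant 1$ and let $f_1,\ldots,f_p:\mathbb{R}^D\to\mathbb{R}^D$ be affine maps, $f_i(x)=A_ix+b_i$. Let $K_0\in\mathcal{K}$. Assume that the sequence $(d_n)_n$ associated with $K_0$ converges to a positive number $d>\lambda_H$. Then the sequence $(K_n)_n$ converges to the attractor $L_d$ of the iterated function system $\big\{\frac1d f_1,\ldots,\frac1d f_p\big\}$.
   Context: $D\geqslant1$; $\|\cdot\|$ is the Euclidean norm on $\mathbb{R}^D$ and also the induced operator norm on $D\times D$ real matrices. $\mathcal{K}$ is the set of non-empty compact subsets of $\mathbb{R}^D$, with the Hausdorff metric; convergence of sets is with respect to this metric. The radius function is $\rho(K)=\sup\{\|x\|:x\in K\}$ for $K\in\mathcal{K}$. The Hutchinson operator is $H(K)=\bigcup_{i=1}^p f_i(K)$, and $\lambda_H=\max_{1\leqslant i\leqslant p}\|A_i\|$. The renormalized operator is $H_\rho(K)=\frac{1}{\rho(H(K))}H(K)$. For $K_0\in\mathcal{K}$ put $K_n=H_\rho^n(K_0)$ and $d_n=\rho(H(K_n))$, so that $K_{n+1}=\frac1{d_n}H(K_n)$ for $n\geqslant0$. Standing assumption: $d_n>0$ for all $n\geqslant0$, so the sequences are well defined. For $d>0$ with $d>\lambda_H$, $L_d$ denotes the unique element of $\mathcal{K}$ with $L_d=\bigcup_{i=1}^p\frac1d f_i(L_d)$ (the attractor of the contractive system $\{\frac1df_1,\ldots,\frac1df_p\}$). *)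

(* Defs.v *)
From mathcomp Require Import all_boot all_order all_algebra.
From mathcomp Require Import all_classical all_reals all_analysis.

Set Implicit Arguments.
Unset Strict Implicit.
Unset Printing Implicit Defensive.

Import Order.TTheory GRing.Theory Num.Theory.
Import numFieldNormedType.Exports.

Local Open Scope classical_set_scope.
Local Open Scope ring_scope.

(* The library norm `|x| on column vectors is the sup norm, hence an explicit
   Euclidean norm; the library topology on 'cV[R]_D is the usual one. *)
Definition enorm (R : realType) (D : nat) (x : 'cV[R]_D) : R :=
  Num.sqrt (\sum_(i < D) x i 0 ^+ 2).

Definition opnorm (R : realType) (D : nat) (A : 'M[R]_D) : R :=
  sup [set enorm (A *m x) | x in [set x : 'cV[R]_D | enorm x <= 1]].

Definition nonempty_compact (R : realType) (D : nat) (K : set 'cV[R]_D) : Prop :=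
  K !=set0 /\ compact K.

Definition dist_to_set (R : realType) (D : nat) (x : 'cV[R]_D)
    (B : set 'cV[R]_D) : R :=
  inf [set enorm (x - y) | y in B].

(* Real-valued sup and inf: meaningful on nonempty compact sets only. *)
Definition hausdorff_dist (R : realType) (D : nat) (A B : set 'cV[R]_D) : R :=
  Num.max (sup [set dist_to_set a B | a in A])
          (sup [set dist_to_set b A | b in B]).

Definition hausdorff_cvg (R : realType) (D : nat) (K : nat -> set 'cV[R]_D)
    (L : set 'cV[R]_D) : Prop :=
  hausdorff_dist (K n) L @[n --> \oo] --> (0 : R).

Definition radius (R : realType) (D : nat) (K : set 'cV[R]_D) : R :=
  sup [set enorm x | x in K].

Definition hutchinson (R : realType) (D p : nat)
    (f : 'I_p -> 'cV[R]_D -> 'cV[R]_D) (K : set 'cV[R]_D) : set 'cV[R]_D :=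
  \bigcup_i (f i @` K).

(* Starting the maximum at 0 is harmless for p >= 1, as opnorm >= 0. *)
Definition lambdaH (R : realType) (D p : nat) (A : 'I_p -> 'M[R]_D) : R :=
  \big[Num.max/0]_(i < p) opnorm (A i).

Definition hutchinson_rho (R : realType) (D p : nat)
    (f : 'I_p -> 'cV[R]_D -> 'cV[R]_D) (K : set 'cV[R]_D) : set 'cV[R]_D :=
  [set (radius (hutchinson f K))^-1 *: x | x in hutchinson f K].

Definition Kseq (R : realType) (D p : nat)
    (f : 'I_p -> 'cV[R]_D -> 'cV[R]_D) (K0 : set 'cV[R]_D) (n : nat) :
    set 'cV[R]_D :=
  iter n (hutchinson_rho f) K0.

Definition dseq (R : realType) (D p : nat)
    (f : 'I_p -> 'cV[R]_D -> 'cV[R]_D) (K0 : set 'cV[R]_D) (n : nat) : R :=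
  radius (hutchinson f (Kseq f K0 n)).

Definition is_attractor (R : realType) (D p : nat)
    (g : 'I_p -> 'cV[R]_D -> 'cV[R]_D) (L : set 'cV[R]_D) : Prop :=
  nonempty_compact L /\ L = \bigcup_i (g i @` L).

(* Main.v *)
Require Import Defs.
From mathcomp Require Import all_boot all_order all_algebra.
From mathcomp Require Import all_classical all_reals all_analysis.
From mathcomp Require Import ring lra.

Import Order.TTheory GRing.Theory Num.Theory.
Import numFieldNormedType.Exports.

Local Open Scope classical_set_scope.
Local Open Scope ring_scope.

(** Each map [f i / s] applied to a set [K] moves by a controlled amount when
    both [s] and [K] vary. Let [c = lambdaH A / d < 1] and let [L] be the
    attractor of the system [f i / d]. If [K_n] and [L] are within Hausdorff
    distance [r], pair a point [x] of [K_n] with a point [y] of [L] at distance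
    at most [r]; then
      [ f_i(x)/d_n - f_i(y)/d = (1/d_n - 1/d) f_i(x) + (f_i(x) - f_i(y))/d ].
    The last term has norm at most [c * r]. In the first one, [f_i(x)] belongs
    to [H(K_n)], whose radius is [d_n] by definition, so that this term has norm
    at most [d_n * |1/d_n - 1/d| = |1 - d_n/d|]. Hence the distances from [K_n]
    to [L] are bounded by numbers [u_n] with [u_(n+1) = c * u_n + e_n], where
    [e_n = |1 - d_n/d|] tends to 0, and such a sequence tends to 0 because
    [c < 1] (contracted_recurrence_cvg0).

    The attractor is built by an order-theoretic argument instead of the
    completeness of the space of compact sets: inside a closed ball mapped into
    itself by every map, the union [L] of all sets [S] with [S] contained in
    [G(S)] is the greatest fixed point of the monotone operator [G]; it is
    closed because its closure has the same property, and nonempty because it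
    contains the fixed points of the individual contractions
    (attractor_exists). Uniqueness is the same pairing argument with constant
    scaling: two attractors at distance at most [r] are at distance at most
    [c^n r] for every [n] (attractor_unique). *)

(** * The Euclidean norm on column vectors *)

Lemma enorm_ge0 {R : realType} {D : nat} (x : 'cV[R]_D) : 0 <= enorm x.
Proof. exact: sqrtr_ge0. Qed.

Lemma enorm_sqr {R : realType} {D : nat} (x : 'cV[R]_D) :
  enorm x ^+ 2 = \sum_(i < D) x i 0 ^+ 2.
Proof. by rewrite sqr_sqrtr// sumr_ge0// => i _; rewrite sqr_ge0. Qed.

Lemma enorm0 {R : realType} {D : nat} : enorm (0 : 'cV[R]_D) = 0.
Proof.
by rewrite /enorm big1 ?sqrtr0// => i _; rewrite mxE expr0n.
Qed.

Lemma enormZ {R : realType} {D : nat} (a : R) (x : 'cV[R]_D) :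
  enorm (a *: x) = `|a| * enorm x.
Proof.
rewrite /enorm -sqrtr_sqr -sqrtrM ?sqr_ge0// mulr_sumr.
by congr Num.sqrt; apply: eq_bigr => i _; rewrite mxE exprMn.
Qed.

Lemma enormN {R : realType} {D : nat} (x : 'cV[R]_D) : enorm (- x) = enorm x.
Proof. by rewrite -scaleN1r enormZ normrN1 mul1r. Qed.

Lemma enormB {R : realType} {D : nat} (x y : 'cV[R]_D) :
  enorm (x - y) = enorm (y - x).
Proof. by rewrite -enormN opprB. Qed.

Lemma le_coord_enorm {R : realType} {D : nat} (x : 'cV[R]_D) i :
  `|x i 0| <= enorm x.
Proof.
rewrite -sqrtr_sqr ler_wsqrtr// (bigD1 i)//= lerDl sumr_ge0// => j _.
by rewrite sqr_ge0.
Qed.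

Lemma enorm_eq0 {R : realType} {D : nat} (x : 'cV[R]_D) : enorm x = 0 -> x = 0.
Proof.
move=> x0; apply/colP => i; rewrite mxE; apply/eqP.
by rewrite -normr_le0 -x0 le_coord_enorm.
Qed.

(** When both norms are nonzero this is the expansion of
    [0 <= | |y| x - |x| y |^2], divided by [2 |x| |y|]. *)
Lemma cauchy_schwarz {R : realType} {D : nat} (x y : 'cV[R]_D) :
  \sum_(i < D) x i 0 * y i 0 <= enorm x * enorm y.
Proof.
have [/enorm_eq0->|x0] := eqVneq (enorm x) 0.
  by rewrite enorm0 mul0r big1// => i _; rewrite mxE mul0r.
have [/enorm_eq0->|y0] := eqVneq (enorm y) 0.
  by rewrite enorm0 mulr0 big1// => i _; rewrite mxE mulr0.
have xy0 : 0 < enorm x * enorm y by rewrite lt0r mulf_neq0//= mulr_ge0 ?enorm_ge0.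
set s := \sum_(i < D) _.
have : 0 <= \sum_(i < D) (enorm y * x i 0 - enorm x * y i 0) ^+ 2.
  by rewrite sumr_ge0// => i _; rewrite sqr_ge0.
have -> : \sum_(i < D) (enorm y * x i 0 - enorm x * y i 0) ^+ 2 =
    2 * (enorm x * enorm y) * (enorm x * enorm y - s).
  transitivity (enorm y ^+ 2 * enorm x ^+ 2 + enorm x ^+ 2 * enorm y ^+ 2
                - 2 * (enorm x * enorm y) * s); last by ring.
  rewrite {1}(enorm_sqr x) {2}(enorm_sqr y) !mulr_sumr -sumrN -!big_split/=.
  by apply: eq_bigr => i _; ring.
have c0 : 0 < 2 * (enorm x * enorm y) by rewrite mulr_gt0.
by rewrite (pmulr_rge0 _ c0) subr_ge0.
Qed.

Lemma enorm_triangle {R : realType} {D : nat} (x y : 'cV[R]_D) :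
  enorm (x + y) <= enorm x + enorm y.
Proof.
rewrite -ler_sqr ?nnegrE ?addr_ge0 ?enorm_ge0//.
have -> : enorm (x + y) ^+ 2 =
    enorm x ^+ 2 + enorm y ^+ 2 + 2 * \sum_(i < D) x i 0 * y i 0.
  rewrite !enorm_sqr mulr_sumr -!big_split/=.
  by apply: eq_bigr => i _; rewrite mxE; ring.
have := cauchy_schwarz x y; lra.
Qed.

Lemma enorm_distD {R : realType} {D : nat} (z x y : 'cV[R]_D) :
  enorm (x - y) <= enorm (x - z) + enorm (z - y).
Proof. by rewrite (le_trans _ (enorm_triangle _ _))// addrA subrK. Qed.

Lemma enorm_le_sum {R : realType} {D : nat} (x : 'cV[R]_D) :
  enorm x <= \sum_(i < D) `|x i 0|.
Proof.
have s0 : 0 <= \sum_(i < D) `|x i 0| by rewrite sumr_ge0.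
rewrite -ler_sqr ?nnegrE ?enorm_ge0// enorm_sqr expr2 mulr_sumr.
apply: ler_sum => i _.
rewrite -real_normK ?num_real// expr2 ler_wpM2r//.
by rewrite (bigD1 i)//= lerDl sumr_ge0.
Qed.

(** The operator norm is a supremum of reals, so its defining property needs
    the set of values to be bounded; the sum of the absolute values of the
    entries of [A] serves as a crude bound. *)
Lemma enorm_mulmx_le {R : realType} {D : nat} (A : 'M[R]_D) (x : 'cV[R]_D) :
  enorm (A *m x) <= opnorm A * enorm x.
Proof.
have bnd : has_ubound
    [set enorm (A *m x) | x in [set x : 'cV[R]_D | enorm x <= 1]].
  exists (\sum_(i < D) \sum_(j < D) `|A i j|) => _ [y /= y1 <-].
  apply: (le_trans (enorm_le_sum _)); apply: ler_sum => i _.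
  rewrite mxE; apply: (le_trans (ler_norm_sum _ _ _)); apply: ler_sum => j _.
  by rewrite normrM ler_piMr// (le_trans (le_coord_enorm _ _)).
have [/enorm_eq0->|x0] := eqVneq (enorm x) 0.
  by rewrite mulmx0 enorm0 mulr0.
have x_gt0 : 0 < enorm x by rewrite lt0r x0 enorm_ge0.
rewrite -ler_pdivrMr// mulrC.
have -> : (enorm x)^-1 * enorm (A *m x) = enorm (A *m ((enorm x)^-1 *: x)).
  by rewrite -scalemxAr enormZ ger0_norm// invr_ge0 ltW.
apply: ub_le_sup => //; exists ((enorm x)^-1 *: x) => //=.
by rewrite enormZ ger0_norm ?invr_ge0 ?(ltW x_gt0)// mulVf.
Qed.

(** * Comparison with the product topology *)

Lemma enorm_continuous {R : realType} {D : nat} :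
  continuous (@enorm R D).
Proof.
move=> x; apply: (@continuous_comp _ _ _
  (fun y : 'cV[R]_D => \sum_(i < D) y i 0 ^+ 2) Num.sqrt); last first.
  exact: sqrt_continuous.
apply: continuous_big => [|i _]; first exact: add_continuous.
move=> y; apply: (@continuous_comp _ _ _ (fun z : 'cV[R]_D => z i 0)
  (fun t : R => t ^+ 2)); [exact: coord_continuous|exact: exprn_continuous].
Qed.

Lemma ball_enorm {R : realType} {D : nat} (x y : 'cV[R]_D) (e : R) :
  enorm (x - y) < e -> ball x e y.
Proof.
move=> xye; split => [|i j]; first exact: le_lt_trans (enorm_ge0 _) xye.
rewrite ord1 /ball/=; apply: le_lt_trans xye.
by have := le_coord_enorm (x - y) i; rewrite !mxE.
Qed.

Definition elipschitz {R : realType} {D : nat} (c : R)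
    (g : 'cV[R]_D -> 'cV[R]_D) : Prop :=
  forall x y, enorm (g x - g y) <= c * enorm (x - y).

Lemma elipschitz_continuous {R : realType} {D : nat} (c : R)
    (g : 'cV[R]_D -> 'cV[R]_D) : elipschitz c g -> continuous g.
Proof.
move=> gc.
have h (x : 'cV[R]_D) :
    {for x, continuous (fun y : 'cV[R]_D => c * enorm (x - y))}.
  apply: (@continuous_comp _ _ _ (fun y : 'cV[R]_D => x - y)
    (fun v => c * enorm v)).
    by apply: continuousB; [exact: cst_continuous|].
  by apply: continuousM; [exact: cst_continuous|exact: enorm_continuous].
move=> x U /nbhs_ballP[e /= e0 eU].
have := h x; rewrite /continuous_at /prop_for /=; rewrite subrr enorm0 mulr0 => {}h.
apply: filterS (cvgr_lt _ h _ e0) => y xy /=.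
apply: eU; apply: ball_enorm; exact: le_lt_trans (gc _ _) xy.
Qed.

Lemma compact_enorm_bounded {R : realType} {D : nat} (K : set 'cV[R]_D) :
  compact K -> exists2 M, 0 <= M & forall x, K x -> enorm x <= M.
Proof.
move=> cK.
have : compact (@enorm R D @` K).
  apply: continuous_compact => //; apply: continuous_subspaceT.
  exact: enorm_continuous.
move=> /compact_bounded[M [_ MK]]; exists (`|M| + 1); first by rewrite addr_ge0.
move=> x Kx; have := MK (`|M| + 1).
rewrite (le_lt_trans (ler_norm _))// ?ltrDl// => /(_ isT (enorm x)) /=.
by rewrite ger0_norm ?enorm_ge0//; apply; exists x.
Qed.

(** Heine-Borel: the ball is closed and lies in a cube, which is the transpose
    of a compact product of segments of row vectors. *)
Lemma compact_eball {R : realType} {D : nat} (r : R) :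
  compact [set x : 'cV[R]_D | enorm x <= r].
Proof.
have trc : continuous (@trmx R 1 D).
  move=> x U /nbhs_ballP[e /= e0 eU]; apply/nbhs_ballP; exists e => //= y [_ xy].
  by apply: eU; split => // i j; rewrite !mxE.
apply: (@subclosed_compact _ _ (trmx @` [set v : 'rV[R]_D | forall i,
    v ord0 i \in `[(- r), r]])).
- apply: (preimage_closed (D := [set y : R | y <= r])); last exact: closed_le.
  by move=> x _; exact: enorm_continuous.
- apply: continuous_compact; first exact: continuous_subspaceT.
  by apply: (@rV_compact _ _ (fun=> `[(- r), r]%classic)) => _; exact: segment_compact.
- move=> x /= xr; exists x^T; rewrite ?trmxK// => i.
  by rewrite mxE in_itv/= -ler_norml (le_trans (le_coord_enorm _ _)).
Qed.

(** * Hutchinson operators and contractions *)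

Lemma compact_hutchinson {R : realType} {D p : nat}
    (g : 'I_p -> 'cV[R]_D -> 'cV[R]_D) (K : set 'cV[R]_D) :
  (forall i, continuous (g i)) -> compact K -> compact (hutchinson g K).
Proof.
move=> gc cK; rewrite /hutchinson.
have -> : [set: 'I_p] = [set` enum 'I_p].
  by apply/seteqP; split => // i _ /=; rewrite mem_enum.
rewrite bigcup_seq; apply: bigsetU_compact => i _.
by apply: continuous_compact => //; exact: continuous_subspaceT.
Qed.

Lemma hutchinson_mono {R : realType} {D p : nat}
    (g : 'I_p -> 'cV[R]_D -> 'cV[R]_D) (K L : set 'cV[R]_D) :
  K `<=` L -> hutchinson g K `<=` hutchinson g L.
Proof. by move=> KL y [i _ [x Kx <-]]; exists i => //; exists x => //; exact: KL. Qed.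

Lemma nonempty_compact_hutchinson {R : realType} {D p : nat}
    (g : 'I_p -> 'cV[R]_D -> 'cV[R]_D) (K : set 'cV[R]_D) : (0 < p)%N ->
  (forall i, continuous (g i)) ->
  nonempty_compact K -> nonempty_compact (hutchinson g K).
Proof.
move=> p0 gc [[x Kx] cK]; split; last exact: compact_hutchinson.
by exists (g (Ordinal p0) x), (Ordinal p0) => //; exists x.
Qed.

Lemma le_radius {R : realType} {D : nat} (K : set 'cV[R]_D) (x : 'cV[R]_D) :
  compact K -> K x -> enorm x <= Defs.radius K.
Proof.
move=> /compact_enorm_bounded[M _ KM] Kx; apply: ub_le_sup; last by exists x.
by exists M => _ [y Ky <-]; exact: KM.
Qed.

Lemma elipschitz_affine {R : realType} {D : nat} (a : R) (A : 'M[R]_D)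
    (b : 'cV[R]_D) : 0 <= a ->
  elipschitz (a * opnorm A) (fun x => a *: (A *m x + b)).
Proof.
move=> a0 x y; rewrite -scalerBr opprD addrACA subrr addr0 -mulmxBr.
by rewrite enormZ ger0_norm// -mulrA ler_wpM2l// enorm_mulmx_le.
Qed.

(** The condition on [g 0] says that the radius [r] is large enough for
    [c * r + |g 0| <= r]. *)
Lemma elipschitz_ball_stable {R : realType} {D : nat} (c r : R)
    (g : 'cV[R]_D -> 'cV[R]_D) : 0 <= c -> elipschitz c g ->
  enorm (g 0) <= (1 - c) * r ->
  forall x, enorm x <= r -> enorm (g x) <= r.
Proof.
move=> c0 gc g0 x xr.
have := enorm_triangle (g x - g 0) (g 0); rewrite subrK => h.
have := gc x 0; rewrite subr0 => h1.
have := ler_wpM2l c0 xr; lra.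
Qed.

(** The displacement [|g x - x|] attains a minimum on the compact ball; were it
    positive, moving from [x] to [g x] would shrink it by the factor [c]. *)
Lemma contraction_fixpoint {R : realType} {D : nat} (c r : R)
    (g : 'cV[R]_D -> 'cV[R]_D) : 0 <= c -> c < 1 -> 0 <= r ->
  elipschitz c g -> enorm (g 0) <= (1 - c) * r ->
  exists2 x, enorm x <= r & g x = x.
Proof.
move=> c0 c1 r0 gc g0.
have cg : continuous g by exact: elipschitz_continuous gc.
have [||x] := compact_EVT_min (f := fun x => enorm (g x - x)) _ (@compact_eball R D r).
- by exists 0 => /=; rewrite enorm0.
- apply: continuous_subspaceT => x.
  apply: (@continuous_comp _ _ _ (fun x => g x - x) (@enorm R D)).
    by apply: continuousB; [exact: cg|].
  exact: enorm_continuous.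
rewrite inE/= => xr xmin; exists x => //.
apply/eqP; rewrite -subr_eq0; apply/eqP/enorm_eq0/eqP.
have : enorm (g x - x) <= enorm (g (g x) - g x).
  by apply: xmin; rewrite inE /=; exact: elipschitz_ball_stable gc g0 _ xr.
move=> /le_trans/(_ (gc _ _)); have := enorm_ge0 (g x - x) => h0 h.
rewrite eq_le h0 andbT -(pmulr_rle0 _ (x := 1 - c)) ?subr_gt0//; lra.
Qed.

(** Knaster-Tarski in a ball [B] stable under all the maps: the attractor is the
    union of the subsets [S] of [B] that are contained in their own image. Its
    closure is compact, and the image of a compact set is closed, so the closure
    is again such an [S]; by maximality the union is closed. The fixed point of
    any of the maps provides a singleton [S]. *)
Lemma attractor_exists {R : realType} {D p : nat} (c : R)
    (g : 'I_p -> 'cV[R]_D -> 'cV[R]_D) : (0 < p)%N -> 0 <= c -> c < 1 ->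
  (forall i, elipschitz c (g i)) -> exists L, is_attractor g L.
Proof.
move=> p0 c0 c1 gc.
have gcont i : continuous (g i) by exact: elipschitz_continuous (gc i).
have c1' : 0 < 1 - c by rewrite subr_gt0.
pose r := (1 - c)^-1 * \sum_i enorm (g i 0).
have r0 : 0 <= r.
  by rewrite mulr_ge0 ?invr_ge0 ?(ltW c1')// sumr_ge0// => i _; exact: enorm_ge0.
have g0 i : enorm (g i 0) <= (1 - c) * r.
  rewrite /r mulVKf ?lt0r_neq0// (bigD1 i)//= lerDl sumr_ge0// => j _.
  exact: enorm_ge0.
pose B := [set x : 'cV[R]_D | enorm x <= r].
pose L := \bigcup_(S in [set S | S `<=` B /\ S `<=` hutchinson g S]) S.
have LB : L `<=` B by move=> x [S [SB _] Sx]; exact: SB.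
have LG : L `<=` hutchinson g L.
  move=> x [S [SB SG] Sx]; apply: (hutchinson_mono _ S); last exact: SG.
  by move=> y Sy; exists S.
have GB : hutchinson g B `<=` B.
  by move=> _ [i _ [x Bx <-]]; exact: elipschitz_ball_stable (gc i) (g0 i) _ Bx.
have maxL S : S `<=` B -> S `<=` hutchinson g S -> S `<=` L.
  by move=> SB SG x Sx; exists S.
have hV : hausdorff_space 'cV[R]_D by exact: norm_hausdorff.
have clB : closed B by apply: compact_closed => //; exact: compact_eball.
have clLB : closure L `<=` B by rewrite closureE => x; apply.
have cclL : compact (closure L).
  by apply: subclosed_compact clLB; [exact: closed_closure|exact: compact_eball].
have clL : closure L `<=` L.
  apply: maxL => //.
  rewrite [X in X `<=` _]closureE; apply: smallest_sub.
    by apply: compact_closed => //; exact: compact_hutchinson.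
  by apply: subset_trans LG _; apply: hutchinson_mono; exact: subset_closure.
have Lcl : L = closure L by apply/seteqP; split => //; exact: subset_closure.
(* The image of L is itself contained in its own image, hence in L. *)
exists L; split; last first.
  apply/seteqP; split => //; apply: maxL; last exact: hutchinson_mono.
  by apply: subset_trans GB; exact: hutchinson_mono.
split; last by rewrite Lcl.
pose i0 := Ordinal p0.
have [x xr gx] := contraction_fixpoint c r (g i0) c0 c1 r0 (gc i0) (g0 i0).
exists x; apply: (maxL [set x]) => //= _ -> //.
by exists i0 => //; exists x.
Qed.

(** * Hausdorff distance through pairing of points *)

Definition dominated {R : realType} {D : nat} (r : R) (K L : set 'cV[R]_D) :
  Prop := forall x, K x -> exists2 y, L y & enorm (x - y) <= r.

(** An upper bound on the Hausdorff distance, phrased with pairs of points so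
    that it propagates through maps without handling suprema and infima. *)
Definition hnear {R : realType} {D : nat} (r : R) (K L : set 'cV[R]_D) : Prop :=
  dominated r K L /\ dominated r L K.

Lemma hnear_bounded {R : realType} {D : nat} (K L : set 'cV[R]_D) :
  nonempty_compact K -> nonempty_compact L ->
  exists2 r, 0 <= r & hnear r K L.
Proof.
move=> [[k Kk] /compact_enorm_bounded[M M0 KM]].
move=> [[l Ll] /compact_enorm_bounded[N N0 LN]].
exists (M + N); first exact: addr_ge0.
have dist x y : K x -> L y -> enorm (x - y) <= M + N.
  move=> /KM xM /LN yN; apply: le_trans (enorm_triangle _ _) _.
  by rewrite enormN lerD.
split => x Hx; first by exists l => //; exact: dist.
by exists k => //; rewrite enormB; exact: dist.
Qed.

(** The two families of maps may differ: this covers both the iteration of one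
    system and the comparison of two rescalings of it. *)
Lemma hnear_hutchinson {R : realType} {D p : nat} (r s : R)
    (g h : 'I_p -> 'cV[R]_D -> 'cV[R]_D) (K L : set 'cV[R]_D) :
  (forall i x y, K x -> L y -> enorm (x - y) <= r -> enorm (g i x - h i y) <= s) ->
  hnear r K L -> hnear s (hutchinson g K) (hutchinson h L).
Proof.
move=> gh [KL LK]; split => _ [i _ [x Hx <-]].
  have [y Ly xy] := KL x Hx; exists (h i y); last exact: gh.
  by exists i => //; exists y.
have [y Ky xy] := LK x Hx; exists (g i y); first by exists i => //; exists y.
by rewrite enormB; apply: gh => //; rewrite enormB.
Qed.

Lemma dist_to_set_ge0 {R : realType} {D : nat} (x : 'cV[R]_D) (B : set 'cV[R]_D) :
  B !=set0 -> 0 <= dist_to_set x B.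
Proof.
move=> [y By]; apply: lb_le_inf; first by exists (enorm (x - y)), y.
by move=> _ [z _ <-]; exact: enorm_ge0.
Qed.

Lemma dist_to_set_le {R : realType} {D : nat} (x y : 'cV[R]_D)
    (B : set 'cV[R]_D) : B y -> dist_to_set x B <= enorm (x - y).
Proof.
move=> By; apply: ge_inf; last by exists y.
by exists 0 => _ [z _ <-]; exact: enorm_ge0.
Qed.

(** A real-valued supremum dominates the members of a set only when the set is
    bounded; here the pairing radius [r] is the bound. *)
Lemma excess_bounds {R : realType} {D : nat} (r : R) (K L : set 'cV[R]_D) :
  K !=set0 -> L !=set0 -> dominated r K L ->
  0 <= sup [set dist_to_set x L | x in K] <= r.
Proof.
move=> [k Kk] L0 KL.
have ub : ubound [set dist_to_set x L | x in K] r.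
  move=> _ [x Kx <-]; have [y Ly] := KL x Kx.
  by apply: le_trans; exact: dist_to_set_le.
apply/andP; split; last by apply: ge_sup => //; exists (dist_to_set k L), k.
apply: le_trans (dist_to_set_ge0 k _ L0) _.
by apply: ub_le_sup; [exists r|exists k].
Qed.

Lemma hausdorff_dist_bounds {R : realType} {D : nat} (r : R)
    (K L : set 'cV[R]_D) : K !=set0 -> L !=set0 -> hnear r K L ->
  0 <= hausdorff_dist K L <= r.
Proof.
move=> K0 L0 [KL LK].
have /andP[h1 h2] := excess_bounds _ _ _ K0 L0 KL.
have /andP[h3 h4] := excess_bounds _ _ _ L0 K0 LK.
by rewrite /hausdorff_dist le_max h1/= ge_max h2 h4.
Qed.

(** Applying the system to both attractors leaves them unchanged and multiplies
    their distance bound by [c], so each is contained in the closure of the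
    other, and both are closed. *)
Lemma attractor_unique {R : realType} {D p : nat} (c : R)
    (g : 'I_p -> 'cV[R]_D -> 'cV[R]_D) (L M : set 'cV[R]_D) : 0 <= c -> c < 1 ->
  (forall i, elipschitz c (g i)) ->
  is_attractor g L -> is_attractor g M -> L = M.
Proof.
move=> c0 c1 gc [cL gL] [cM gM].
have [r r0 LM] := hnear_bounded L M cL cM.
have near_n n : hnear (c ^+ n * r) L M.
  elim: n => [|n IH]; first by rewrite mul1r.
  rewrite gL gM; apply: hnear_hutchinson IH => i x y _ _ xy.
  by apply: le_trans (gc i _ _) _; rewrite exprS -mulrA ler_wpM2l.
have small e : 0 < e -> exists n, c ^+ n * r < e.
  move=> e0; have : geometric r c @ \oo --> 0.
    by apply: cvg_geometric; rewrite ger0_norm.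
  move=> /cvgr_lt/(_ e e0)[n _ /(_ n (leqnn n))] /=; rewrite mulrC => h.
  by exists n.
have sub (X Y : set 'cV[R]_D) : compact Y ->
    (forall n, dominated (c ^+ n * r) X Y) -> X `<=` Y.
  move=> cY XY x Xx.
  have : closed Y by apply: compact_closed => //; exact: norm_hausdorff.
  apply => U /nbhs_ballP[e /= e0 eU].
  have [n ne] := small e e0; have [y Yy xy] := XY n x Xx.
  exists y; split => //; apply: eU; apply: ball_enorm.
  exact: le_lt_trans ne.
by apply/seteqP; split; apply: sub; [case: cM|move=> n; case: (near_n n)|
  case: cL|move=> n; case: (near_n n)].
Qed.

(** * Convergence of the renormalized iterates *)

(** Once [e n < (1 - c) * eps / 2], the number [eps / 2] is a supersolution of
    the recurrence, so that [u] exceeds it by at most a geometric term. *)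
Lemma contracted_recurrence_cvg0 {R : realType} (c : R) (u e : R^nat) :
  0 <= c -> c < 1 -> (forall n, 0 <= u n) ->
  (forall n, u n.+1 <= c * u n + e n) ->
  e @ \oo --> 0 -> u @ \oo --> 0.
Proof.
move=> c0 c1 u0 uS e0; apply/cvgrPdist_lt => eps eps0.
have c1' : 0 < 1 - c by rewrite subr_gt0.
have : 0 < (1 - c) * (eps / 2) by rewrite mulr_gt0// divr_gt0.
move=> /(cvgr_lt _ e0)[N _ eN].
have uN k : u (k + N)%N <= c ^+ k * u N + eps / 2.
  elim: k => [|k IH]; first by rewrite mul1r lerDl divr_ge0// ltW.
  have := eN (k + N)%N (leq_addl _ _) => /= h1.
  have := uS (k + N)%N; have := ler_wpM2l c0 IH; rewrite addSn exprS; lra.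
have : geometric (u N) c @ \oo --> 0.
  by apply: cvg_geometric; rewrite ger0_norm.
have eps2 : 0 < eps / 2 by rewrite divr_gt0.
move=> /cvgr_lt/(_ _ eps2)[M _ cM].
exists (M + N)%N => // n /= MNn; rewrite sub0r normrN ger0_norm//.
have Nn : (N <= n)%N by rewrite (leq_trans _ MNn)// leq_addl.
have := uN (n - N)%N; rewrite subnK// => h.
have /= := cM (n - N)%N; rewrite leq_subRL// addnC => /(_ MNn) h2; lra.
Qed.

(** Renormalizing the image is the same as rescaling the maps, so one step of the
    renormalized dynamics is a Hutchinson operator. *)
Lemma hutchinson_rhoE {R : realType} {D p : nat}
    (f : 'I_p -> 'cV[R]_D -> 'cV[R]_D) (K : set 'cV[R]_D) :
  hutchinson_rho f K =
  hutchinson (fun i x => (Defs.radius (hutchinson f K))^-1 *: f i x) K.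
Proof.
apply/seteqP; split.
  by move=> _ [_ [i _ [x Kx <-]] <-]; exists i => //; exists x.
by move=> _ [i _ [x Kx <-]]; exists (f i x) => //; exists i => //; exists x.
Qed.

Theorem theorem2p1 (R : realType) (D p : nat) (hD : (1 <= D)%N) (hp : (1 <= p)%N)
    (A : 'I_p -> 'M[R]_D) (b : 'I_p -> 'cV[R]_D)
    (f : 'I_p -> 'cV[R]_D -> 'cV[R]_D)
    (hf : forall (i : 'I_p) (x : 'cV[R]_D), f i x = A i *m x + b i)
    (K0 : set 'cV[R]_D) (hK0 : nonempty_compact K0)
    (hpos : forall n : nat, 0 < dseq f K0 n)
    (d : R) (hd : 0 < d) (hdlam : lambdaH A < d)
    (hlim : dseq f K0 n @[n --> \oo] --> d) :
  exists L : set 'cV[R]_D,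
    unique (is_attractor (fun (i : 'I_p) (x : 'cV[R]_D) => d^-1 *: f i x)) L
    /\ hausdorff_cvg (Kseq f K0) L.
Proof.
pose c := d^-1 * lambdaH A.
have dV0 : 0 <= d^-1 by rewrite invr_ge0 ltW.
have c0 : 0 <= c by rewrite mulr_ge0//; exact: bigmax_ge_id.
have c1 : c < 1 by rewrite /c mulrC ltr_pdivrMr// mul1r.
have fL a i : 0 <= a -> elipschitz (a * lambdaH A) (fun x => a *: f i x).
  move=> a0 x y; rewrite !hf; apply: le_trans (elipschitz_affine _ _ _ a0 _ _) _.
  by rewrite ler_wpM2r ?enorm_ge0// ler_wpM2l//; exact: le_bigmax.
have gL i : elipschitz c (fun x => d^-1 *: f i x) by exact: fL.
have [L attL] := attractor_exists c _ hp c0 c1 gL.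
exists L; split.
  by split => // M attM; exact: attractor_unique c0 c1 gL attL attM.
have cf a i : 0 <= a -> continuous (fun x => a *: f i x).
  by move=> a0; exact: elipschitz_continuous (fL a i a0).
(* Compactness of the unscaled image makes its radius an honest bound. *)
have compH K : nonempty_compact K -> nonempty_compact (hutchinson f K).
  apply: nonempty_compact_hutchinson => // i.
  have <- : (fun x => 1 *: f i x) = f i by apply/funext => x; rewrite scale1r.
  exact: cf.
pose K := Kseq f K0; pose dn := dseq f K0.
have KS n : K n.+1 = hutchinson (fun i x => (dn n)^-1 *: f i x) (K n).
  by rewrite -hutchinson_rhoE.
have dnV0 n : 0 <= (dn n)^-1 by rewrite invr_ge0 ltW//; exact: hpos.
have compK n : nonempty_compact (K n).
  elim: n => // n IH; rewrite KS; apply: nonempty_compact_hutchinson => // i.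
  exact: cf.
case: attL => compL LE.
have [r0 r00 near0] := hnear_bounded _ _ (compK 0%N) compL.
(* u bounds the distance from K n to L: c is the contraction, and e n the cost
   of dividing by dn n instead of d. *)
pose e n := `|1 - d^-1 * dn n|.
pose u n := iteri n (fun k r => c * r + e k) r0.
have nearK n : hnear (u n) (K n) L.
  elim: n => // n IH; rewrite KS LE; apply: hnear_hutchinson IH => i x y Kx Ly xy.
  (* Change the scaling at x first, then move from x to y. *)
  apply: le_trans (enorm_distD (d^-1 *: f i x) _ _) _.
  rewrite addrC; apply: lerD.
    by apply: le_trans (gL i _ _) _; rewrite ler_wpM2l.
  rewrite -scalerBl enormZ.
  (* f i x lies in the set whose radius defines dn n. *)
  have fx : enorm (f i x) <= dn n.
    apply: le_radius; first by case: (compH _ (compK n)).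
    by exists i => //; exists x.
  apply: le_trans (ler_wpM2l (normr_ge0 _) fx) _.
  have dn0 : 0 < dn n := hpos n.
  by rewrite -{2}(gtr0_norm dn0) -normrM mulrBl mulVf ?lt0r_neq0.
have u0 n : 0 <= u n.
  elim: n => [|n IH]; first exact: r00.
  exact: addr_ge0 (mulr_ge0 c0 IH) (normr_ge0 _).
have e0 : e @ \oo --> 0.
  have : `|1 - d^-1 * dn n| @[n --> \oo] --> `|1 - d^-1 * d|.
    apply: cvg_norm; apply: cvgB; first exact: cvg_cst.
    exact: cvgMl_tmp.
  by rewrite mulVf ?lt0r_neq0// subrr normr0.
have ucvg : u @ \oo --> 0.
  by apply: contracted_recurrence_cvg0 c0 c1 u0 _ e0.
apply: (squeeze_cvgr _ (cvg_cst 0) ucvg).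
near=> n; apply: hausdorff_dist_bounds; last exact: nearK.
  by case: (compK n).
by case: compL.
Unshelve. all: by end_near. Qed.
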